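(* For every $n\ge 3$, every irreducible subcube partition of $\{0,1\}^n$ has size at most $\frac{2n-1}{3n-1}2^n$.
   Context: A subcube partition of length $n$ is a partition of $\{0,1\}^n$ into subcubes (sets obtained by fixing some coordinates to given bits); its size is the number of subcubes. It is irreducible if there is no subset $G$ with $1<|G|<|F|$ whose union is a subcube. *)

(* Defs.v *)
From HB Require Import structures.
From mathcomp Require Import all_boot all_order all_algebra.

Set Implicit Arguments.
Unset Strict Implicit.
Unset Printing Implicit Defensive.

Definition cube (n : nat) : finType := {ffun 'I_n -> bool}.

(* [rho i = Some b] fixes coordinate [i] to the bit [b]; [rho i = None] leaves
   it free. *)
Definition subcube (n : nat) (rho : {ffun 'I_n -> option bool}) :
    {set cube n} :=
  [set x : cube n | [forall i, if rho i is Some b then x i == b else true]].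

Definition is_subcube (n : nat) (A : {set cube n}) : bool :=
  [exists rho : {ffun 'I_n -> option bool}, A == subcube rho].

Definition subcube_partition (n : nat) (F : {set {set cube n}}) : bool :=
  partition F [set: cube n] && [forall A in F, is_subcube A].

Definition irreducible (n : nat) (F : {set {set cube n}}) : Prop :=
  ~ exists G : {set {set cube n}},
      [/\ G \subset F, 1 < #|G| < #|F| & is_subcube (cover G)].

(* Main.v *)
Require Import Defs.
From mathcomp Require Import all_boot all_order all_algebra.
From mathcomp Require Import zify lra.
Set Implicit Arguments.
Unset Strict Implicit.
Unset Printing Implicit Defensive.
Import Order.TTheory GRing.Theory Num.Theory.
Local Open Scope ring_scope.

(** Call a point of the cube lonely if it is a block of the partition.
    Irreducibility forbids two adjacent lonely points, since they would merge
    into an edge.  Count the pairs (y, i) such that the i-th neighbour of y is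
    lonely: there are n for each lonely point.  Such a y lies in a block A with
    at least two points; if j is a free direction of A, then the direction j
    contributes nothing in A, and for every other i at most one of y and its
    j-th neighbour contributes.  So A accounts for at most (n-1)|A|/2 pairs,
    and (n-1)|A|/2 <= (2n-1)|A| - (3n-1) as soon as |A| >= 2.  Summing over
    all blocks gives (3n-1)|F| <= (2n-1)2^n. *)

Section Flip.
Variable n : nat.
Implicit Types (x y : cube n) (i j : 'I_n) (A : {set cube n}).

Definition flip i x : cube n := [ffun k => if k == i then ~~ x k else x k].

Lemma flipK i : involutive (flip i).
Proof. by move=> x; apply/ffunP => k; rewrite !ffunE; case: eqP; rewrite ?negbK. Qed.

Lemma flipC i j x : flip i (flip j x) = flip j (flip i x).
Proof. by apply/ffunP => k; rewrite !ffunE; do 2!case: eqP. Qed.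

Lemma flip_neq i x : flip i x != x.
Proof. by apply/eqP => /ffunP /(_ i); rewrite ffunE eqxx; case: (x i). Qed.

Lemma is_subcube_edge i x : is_subcube [set x; flip i x].
Proof.
apply/existsP; exists [ffun k => if k == i then None else Some (x k)].
apply/eqP/setP => y; rewrite !inE; apply/idP/forallP.
  by case/orP => /eqP -> k; rewrite !ffunE; case: eqP => // _; rewrite eqxx.
move=> yP; have yE k : k != i -> y k = x k.
  by move=> /negPf ki; have := yP k; rewrite ffunE ki => /eqP.
have [yi|yi] := eqVneq (y i) (x i); apply/orP; [left|right]; apply/eqP/ffunP => k.
  by have [->|/yE] := eqVneq k i.
rewrite ffunE; have [->|/yE//] := eqVneq k i.
by move: yi; case: (y i) (x i) => [] [].
Qed.

(** Two distinct points of [A] differ at some [j], so [rho] cannot fix [j]. *)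
Lemma subcube_free_direction A :
  is_subcube A -> (1 < #|A|)%N -> exists j, forall x, x \in A -> flip j x \in A.
Proof.
case/existsP => rho /eqP -> /card_gt1P [x [y [xA yA xy]]].
have /existsP [j xyj] : [exists j, x j != y j].
  apply: contraNT xy; rewrite negb_exists => /forallP xyE.
  by apply/eqP/ffunP => k; apply/eqP; have := xyE k; rewrite negbK.
exists j => z; rewrite !inE => /forallP zA; apply/forallP => k.
rewrite ffunE; have [->|_] := eqVneq k j; last exact: zA.
move: xA yA xyj; rewrite !inE => /forallP/(_ j) + /forallP/(_ j).
by case: (rho j) => // b /eqP -> /eqP ->; rewrite eqxx.
Qed.

Lemma card_flip_preim i (S : {set cube n}) : #|[set y | flip i y \in S]| = #|S|.
Proof.
rewrite -(card_imset S (inv_inj (flipK i))) (can_imset_pre _ (flipK i)).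
by apply: eq_card => y; rewrite !inE.
Qed.

End Flip.

Section Count.
Variables (n : nat) (F : {set {set cube n}}).
Hypotheses (hF : subcube_partition F) (hirr : irreducible F) (F_gt2 : (2 < #|F|)%N).
Implicit Types (x y : cube n) (A : {set cube n}).

Definition lonely := [set x : cube n | [set x] \in F].

Definition lonely_degree A := (\sum_(i < n) #|[set y in A | flip i y \in lonely]|)%N.

Lemma lonely_flip i x : x \in lonely -> flip i x \notin lonely.
Proof.
rewrite !inE => xF; apply/negP => yF; apply: hirr.
exists [set [set x]; [set flip i x]]; split.
- by apply/subsetP => B; rewrite !inE => /orP [] /eqP ->.
(* The two singletons form a proper subfamily of [F] because of [F_gt2]. *)
- by rewrite cards2 (inj_eq set1_inj) eq_sym flip_neq.
- by rewrite /cover bigcup_setU !big_set1 is_subcube_edge.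
Qed.

Lemma lonely_block x A : x \in lonely -> A \in F -> x \in A -> A = [set x].
Proof.
have [/and3P [_ /trivIsetP tF _] _] := andP hF.
rewrite inE => xF AF xA; apply/eqP/negPn/negP => neq.
by have /pred0P/(_ x) := tF _ _ AF xF neq; rewrite /= xA inE eqxx.
Qed.

Lemma lonely_degree_singleton x : x \in lonely -> lonely_degree [set x] = 0%N.
Proof.
move=> xL; apply: big1 => i _; apply/eqP; rewrite cards_eq0.
apply/eqP/setP => y; rewrite !inE; apply/negP => /andP [/eqP -> yF].
by have := lonely_flip i xL; rewrite inE yF.
Qed.

Lemma lonely_degree_bound A :
  A \in F -> (1 < #|A|)%N -> (2 * lonely_degree A <= n.-1 * #|A|)%N.
Proof.
move=> AF A_gt1; have [_ /forall_inP/(_ A AF) Asub] := andP hF.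
have [j jA] := subcube_free_direction Asub A_gt1.
rewrite /lonely_degree (bigD1 j) //=.
(* A lonely [flip j y] would lie in [A] and force [A] to be a singleton. *)
have -> : [set y in A | flip j y \in lonely] = set0.
  apply/setP => y; rewrite in_set in_set0; apply/negP => /andP [yA yL].
  by move: A_gt1; rewrite (lonely_block yL AF (jA _ yA)) cards1.
rewrite cards0 add0n big_distrr /=.
have <- : #|[pred i | i != j]| = n.-1.
  by have := cardC1 j; rewrite card_ord.
rewrite -sum_nat_const; apply: leq_sum => i _.
set T := [set _ in A | _].
(* The factor 2 counts [T] and its image under [flip j], both inside [A]. They are disjoint: as
   flips commute, a common point would give two lonely points adjacent in direction [j]. *)
rewrite mul2n -addnn -{2}(card_imset T (inv_inj (flipK j))).
rewrite -cardsUI (_ : _ :&: _ = set0) ?cards0 ?addn0.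
  apply/subset_leq_card/subsetP => y /setUP [|/imsetP [z + ->]].
    by rewrite in_set => /andP [].
  by rewrite in_set => /andP [/jA].
apply/setP => y; rewrite in_set0; apply/negP => /setIP [yT /imsetP [z zT yE]].
move: yT; rewrite yE in_set flipC => /andP [_]; apply/negP/lonely_flip.
by move: zT; rewrite in_set => /andP [].
Qed.

(** Double counting: for each fixed [i], the blocks partition the cube and [flip i] is a bijection,
    so every lonely point is hit exactly once. *)
Lemma sum_lonely_degree : (\sum_(A in F) lonely_degree A = n * #|lonely|)%N.
Proof.
have [partF _] := andP hF.
rewrite exchange_big /= (_ : n * _ = \sum_(i < n) #|lonely|)%N; last first.
  by rewrite sum_nat_const card_ord.
apply: eq_bigr => i _; rewrite -(card_flip_preim i lonely).
rewrite -[RHS]sum1dep_card [RHS](eq_bigl (fun y => (y \in [set: cube n]) && (flip i y \in lonely))).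
  rewrite (set_partition_big_cond _ partF) /=.
  by apply: eq_bigr => A _; rewrite -sum1_card; apply: eq_bigl => y; rewrite !inE.
by move=> y; rewrite in_setT.
Qed.

Lemma card_lonely_blocks : #|[set A in F | #|A| == 1%N]| = #|lonely|.
Proof.
rewrite -(card_imset lonely set1_inj); congr #|pred_of_set _|.
apply/setP => A; rewrite inE; apply/andP/imsetP => [[AF /cards1P [x Ax]]|[x]].
  by exists x; rewrite // inE -Ax.
by rewrite inE => xF ->; rewrite cards1.
Qed.

(** The term [n * (#|A| == 1)] credits each lonely point with the [n] pairs it generates. For
    singletons this gives equality; for larger blocks, [lonely_degree_bound] leaves (3n-1)|A|/2 >=
    3n-1 to check. *)
Lemma block_bound A : A \in F ->
  ((3 * n - 1) + lonely_degree A <= (2 * n - 1) * #|A| + n * (#|A| == 1))%N.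
Proof.
move=> AF; have [/and3P [_ _ F0] _] := andP hF.
have A_gt0 : (0 < #|A|)%N by rewrite card_gt0; apply: contraNneq F0 => <-.
have [/eqP/cards1P [x Ax]|A1] := eqVneq #|A| 1%N.
  by rewrite Ax lonely_degree_singleton ?cards1 ?inE -?Ax //; lia.
have A_gt1 : (1 < #|A|)%N by lia.
have := lonely_degree_bound AF A_gt1; nia.
Qed.

Lemma irreducible_card_bound : ((3 * n - 1) * #|F| <= (2 * n - 1) * 2 ^ n)%N.
Proof.
have [partF _] := andP hF.
have cardT : (2 ^ n = \sum_(A in F) #|A|)%N.
  by rewrite -(card_partition partF) cardsT card_ffun card_bool card_ord.
(* Add the number of pairs to both sides: on the left it is distributed as degrees over all blocks,
   on the right as credit [n] on each singleton. The inequality then holds block by block. *)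
rewrite -(leq_add2r (n * #|lonely|)) -{1}sum_lonely_degree mulnC.
rewrite -sum_nat_const -big_split cardT -card_lonely_blocks -sum1dep_card.
rewrite big_mkcondr /= !big_distrr /= -big_split /=.
by apply: leq_sum => A AF; have := block_bound AF; case: eqP.
Qed.

End Count.

Theorem theorem2p39 (n : nat) (hn : (3 <= n)%N) (F : {set {set cube n}})
    (hF : subcube_partition F) (hirr : irreducible F) :
  #|F|%:R <= (2 * n%:R - 1) / (3 * n%:R - 1) * 2 ^+ n :> rat.
Proof.
have bound : ((3 * n - 1) * #|F| <= (2 * n - 1) * 2 ^ n)%N.
  have [F_le2|F_gt2] := leqP #|F| 2; last exact: irreducible_card_bound.
  have : (2 ^ 3 <= 2 ^ n)%N by rewrite leq_exp2l.
  nia.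
have n3 : 3 <= n%:R :> rat by rewrite ler_nat.
rewrite mulrAC ler_pdivlMr; last by lra.
move: bound; rewrite -(ler_nat rat) !natrM !natrB ?natrX ?natrM; try lia.
by rewrite mulrC.
Qed.
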